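(* Let $(\nu_d,\nu^\Box_d)_{d\in\mathbb N}$ be a sequence of pairs of Borel probability measures on $\mathbb R$ such that each $\nu_d$ has finite moments of all orders, each $\nu^\Box_d$ is compactly supported, $\lim_{d\to\infty}|m_k(\nu_d)-m_k(\nu^\Box_d)|=0$ for every $k\in\mathbb N$, and there is $M'>0$ with $\operatorname{supp}\nu^\Box_d\subset[-M',M']$ for all $d$. Then for every $\gamma>0$ and $M>0$, \[\lim_{d\to\infty}\sup_{\mu\in\mathcal B_M}\big|H_\gamma(\nu_d,\mu)-H_\gamma(\nu^\Box_d,\mu)\big|=0.\]
   Context: $m_k(\mu)=\int x^k\mu(dx)$. $\mathcal B_M$ is the set of Borel probability measures on $\mathbb R$ with support in $[-M,M]$. $P_\gamma(x)=\frac{\gamma}{\pi(x^2+\gamma^2)}$, $(P_\gamma*\nu)(x)=\int P_\gamma(x-t)\nu(dt)$, $G_\mu(z)=\int\frac{\mu(dt)}{z-t}$. For compactly supported $\mu$ and $\nu$ with finite second moment, $H_\gamma(\nu,\mu)=\int\ell_\gamma(x,\mu)(P_\gamma*\nu)(x)dx$ with $\ell_\gamma(x,\mu)=-\log[-\frac1\pi\operatorname{Im}G_\mu(x+i\gamma)]$. *)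

(* Defs.v *)
From HB Require Import structures.
From mathcomp Require Import all_boot all_order all_algebra.
From mathcomp Require Import all_classical all_reals all_analysis.
From mathcomp Require Import complex.
Set Implicit Arguments. Unset Strict Implicit. Unset Printing Implicit Defensive.
Import Order.TTheory GRing.Theory Num.Theory.
Import numFieldNormedType.Exports.
Local Open Scope classical_set_scope.
Local Open Scope ring_scope.

Section Defs.
Variable R : realType.

(* Borel probability measures on R (sigma-algebra generated by intervals). *)
Notation probR := (probability R R).

(* k-th moment  m_k(mu) = \int x^k mu(dx)  (real-valued; meaningful when integrable) *)
Definition moment (mu : probR) (k : nat) : R :=
  fine (\int[mu]_x (x ^+ k)%:E)%E.

Definition finite_moments (mu : probR) : Prop :=
  forall k : nat, mu.-integrable setT (fun x : R => (x ^+ k)%:E).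

Definition msupport (mu : probR) : set R :=
  [set x | forall r : R, 0 < r -> (0 < mu (ball x r))%E].

Definition compactly_supported (mu : probR) : Prop := compact (msupport mu).

Definition BM (M : R) : set probR :=
  [set mu | msupport mu `<=` `[- M, M]].

Definition Poisson (g x : R) : R := g / (pi * (x ^+ 2 + g ^+ 2)).

Definition Pconv (g : R) (nu : probR) (x : R) : R :=
  fine (\int[nu]_t (Poisson g (x - t))%:E)%E.

(* Imaginary part of the Cauchy-Stieltjes transform G_mu(z) = \int mu(dt)/(z - t),
   computed as \int Im (1/(z - t)) mu(dt) (Im commutes with the integral). *)
Definition ImG (mu : probR) (z : R[i]) : R :=
  fine (\int[mu]_t (@complex.Im R ((z - t%:C)^-1)%C)%:E)%E.

Definition ell (g : R) (x : R) (mu : probR) : R :=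
  - ln (- pi^-1 * ImG mu (x +i* g)%C).

Definition Hg (g : R) (nu mu : probR) : R :=
  fine (\int[lebesgue_measure]_x (ell g x mu * Pconv g nu x)%:E)%E.

End Defs.

(* Main.v *)
(** Writing P for the Poisson kernel of parameter g, [ell g x mu] is - ln (P * mu)(x), so
    by Fubini H(nu, mu) is the integral against nu of
    phi_mu(t) := \int ell(x, mu) P(x - t) dx.  For mu in B_M, ell grows at most like the
    square root of 1 + |x|, uniformly in mu, and Harnack's inequality
    P(x - t) <= (1 + h + h^2) P(x - s), h = |t - s| / g, then makes the phi_mu uniformly
    Lipschitz on compact sets and uniformly of quadratic growth.

    For such a family, Bernstein polynomials on [-K, K], K = M' + 1, have an error bounded
    on the whole line by eps + D (t / K)^(2m), with m as large as one wishes.  The 2m-th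
    moment of nu_d is eventually at most M'^(2m) + o(1) and M' < K, so the error integrates
    to something small; the polynomials themselves are controlled by the convergence of
    finitely many moments, uniformly because their values at the nodes are bounded. *)
Require Import Defs.
From HB Require Import structures.
From mathcomp Require Import all_boot all_order all_algebra.
From mathcomp Require Import all_classical all_reals all_analysis.
From mathcomp Require Import complex.
From mathcomp Require Import measurable_realfun ring lra.
Set Implicit Arguments. Unset Strict Implicit. Unset Printing Implicit Defensive.
Import Order.TTheory GRing.Theory Num.Theory.
Import numFieldNormedType.Exports.
Local Open Scope classical_set_scope.
Local Open Scope ring_scope.

(** * Bernstein polynomials *)

Section BernsteinBasis.
Context {A : comNzRingType}.
Implicit Types (x y : A) (c : nat -> A) (n k : nat).

(* [x] ranges over an arbitrary commutative ring, in order to be specialized both to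
   a number and to a polynomial. *)
Definition bernstein_basis n k x : A := x ^+ k * (1 - x) ^+ (n - k) *+ 'C(n, k).

Lemma sum_bernstein_basis n x : \sum_(k < n.+1) bernstein_basis n k x = 1.
Proof.
have := exprDn (1 - x) x n; rewrite subrK expr1n => ->.
by apply: eq_bigr => k _; rewrite /bernstein_basis mulrC.
Qed.

Lemma bernstein_basisS0 n x : bernstein_basis n.+1 0 x = (1 - x) * bernstein_basis n 0 x.
Proof. by rewrite /bernstein_basis !bin0 !expr0 !subn0 !mulr1n !mul1r exprS. Qed.

Lemma bernstein_basisSS n k x : bernstein_basis n.+1 k.+1 x
  = x * bernstein_basis n k x + (1 - x) * bernstein_basis n k.+1 x.
Proof.
rewrite /bernstein_basis binS addnC subSS mulrnDr !mulrnAr mulrA -exprS; congr (_ + _).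
have [nk|kn] := leqP n k; first by rewrite bin_small// !mulr0n.
by rewrite mulrCA -exprS subnSK.
Qed.

Lemma sum_bernstein_basisS n x c :
  \sum_(k < n.+2) c k * bernstein_basis n.+1 k x
  = x * (\sum_(k < n.+1) c k.+1 * bernstein_basis n k x)
    + (1 - x) * \sum_(k < n.+1) c k * bernstein_basis n k x.
Proof.
have out : bernstein_basis n n.+1 x = 0 by rewrite /bernstein_basis bin_small.
have -> : \sum_(k < n.+1) c k * bernstein_basis n k x
    = \sum_(k < n.+2) c k * bernstein_basis n k x.
  by rewrite [RHS]big_ord_recr/= out mulr0 addr0.
rewrite big_ord_recl [X in (1 - x) * X]big_ord_recl/= bernstein_basisS0.
under eq_bigr do rewrite bernstein_basisSS mulrDr.
rewrite big_split/= mulrDr !mulr_sumr addrCA.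
by congr (_ + (_ + _)); [|ring|]; apply: eq_bigr => k _; ring.
Qed.

Lemma sum_sqr_bernstein_basis n x y :
  \sum_(k < n.+1) (k%:R - y) ^+ 2 * bernstein_basis n k x
  = n%:R * x * (1 - x) + (n%:R * x - y) ^+ 2.
Proof.
elim: n y => [|n IH] y.
  by rewrite big_ord1 /bernstein_basis/= bin0 !expr0 mulr1n; ring.
rewrite (sum_bernstein_basisS n x (fun k => (k%:R - y) ^+ 2)) IH.
have -> : \sum_(k < n.+1) (k.+1%:R - y) ^+ 2 * bernstein_basis n k x
    = \sum_(k < n.+1) (k%:R - (y - 1)) ^+ 2 * bernstein_basis n k x.
  by apply: eq_bigr => k _; rewrite -natr1; ring.
by rewrite IH -natr1; ring.
Qed.
End BernsteinBasis.

Lemma horner_bernstein_basis (A : comNzRingType) n k (p : {poly A}) t :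
  (bernstein_basis n k p).[t] = bernstein_basis n k p.[t].
Proof.
by rewrite /bernstein_basis hornerMn hornerM !horner_exp hornerD hornerN hornerC.
Qed.

Lemma bernstein_basis_ge0 (A : realDomainType) n k (x : A) :
  0 <= x <= 1 -> 0 <= bernstein_basis n k x.
Proof.
by move=> /andP[x0 x1]; rewrite mulrn_wge0// mulr_ge0// exprn_ge0// subr_ge0.
Qed.

Lemma sum_normr_bernstein_basis (A : realDomainType) n (x : A) :
  \sum_(k < n.+1) `|bernstein_basis n k x| = (`|x| + `|1 - x|) ^+ n.
Proof.
rewrite addrC exprDn; apply: eq_bigr => k _.
by rewrite normrMn normrM !normrX mulrC.
Qed.

Section EvenGrowth.
Context {R : realDomainType}.
Implicit Types (A K t : R) (f : R -> R) (q : nat).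

Lemma exprn_double_ge0 t q : 0 <= t ^+ q.*2.
Proof. by rewrite exprn_even_ge0// odd_double. Qed.

Lemma normrX_double t q : `|t| ^+ q.*2 = t ^+ q.*2.
Proof. by rewrite -normrX ger0_norm// exprn_double_ge0. Qed.

Definition even_growth A q f := forall t, `|f t| <= A * (1 + t ^+ q.*2).

Lemma even_growth_ge0 A q f : even_growth A q f -> 0 <= A.
Proof.
move=> /(_ 0) /(le_trans (normr_ge0 _)).
by rewrite pmulr_lge0// ltr_pwDl// exprn_double_ge0.
Qed.

Lemma even_growth_bounded A q f K t : even_growth A q f -> `|t| <= K ->
  `|f t| <= A * (1 + K ^+ q.*2).
Proof.
move=> fA tK; apply: le_trans (fA t) _.
rewrite ler_wpM2l ?(even_growth_ge0 fA)// lerD2l -normrX_double.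
by rewrite lerXn2r ?nnegrE// (le_trans _ tK).
Qed.
End EvenGrowth.

Section BernsteinApprox.
Context {R : realFieldType}.
Implicit Types (K L A C d eps t u : R) (f : R -> R) (k n m q : nat).

Definition bernstein_node K n k : R := K * (2 * k%:R / n%:R - 1).

Definition unit_coord K : {poly R} := (2 * K)^-1 *: ('X + K%:P).

Definition bernstein_approx K n f : {poly R} :=
  \sum_(k < n.+1) f (bernstein_node K n k) *: bernstein_basis n k (unit_coord K).

Lemma horner_unit_coord K t : (unit_coord K).[t] = (t + K) / (2 * K).
Proof. by rewrite !hornerE mulrC. Qed.

Lemma horner_bernstein_approx K n f t : (bernstein_approx K n f).[t]
  = \sum_(k < n.+1) f (bernstein_node K n k) * bernstein_basis n k ((t + K) / (2 * K)).
Proof.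
rewrite horner_sum; apply: eq_bigr => k _.
by rewrite hornerZ horner_bernstein_basis horner_unit_coord.
Qed.

Lemma normr_bernstein_node_le K n k : 0 < K -> (k <= n)%N ->
  `|bernstein_node K n k| <= K.
Proof.
move=> K0 kn; rewrite /bernstein_node -mulrA; set u : R := k%:R / n%:R.
have u0 : 0 <= u by exact: divr_ge0.
have u1 : u <= 1.
  case: n kn @u u0 => [|n] kn u u0; first by rewrite /u invr0 mulr0.
  by rewrite ler_pdivrMr ?ltr0n// mul1r ler_nat.
by rewrite ler_norml; apply/andP; split; nra.
Qed.

Lemma subr_bernstein_node K n k t : 0 < K -> (0 < n)%N ->
  t - bernstein_node K n k = 2 * K / n%:R * (n%:R * ((t + K) / (2 * K)) - k%:R).
Proof.
by move=> K0 n0; rewrite /bernstein_node; field; rewrite gt_eqF ?pnatr_eq0 -?lt0n.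
Qed.

Lemma unit_coord_itv01 K t : 0 < K -> `|t| <= K -> 0 <= (t + K) / (2 * K) <= 1.
Proof.
move=> K0; rewrite ler_norml => /andP[Kt tK].
by rewrite ler_pdivlMr ?ler_pdivrMr ?mulr_gt0// mul0r mul1r; apply/andP; split; lra.
Qed.

Lemma ler_norm_addr_sqr_div d u : 0 < d -> `|u| <= d + u ^+ 2 / d.
Proof.
move=> d0; rewrite -[u ^+ 2]real_normK ?num_real//.
have [ud|du] := leP `|u| d; first by rewrite ler_wpDr// divr_ge0 ?exprn_ge0// ltW.
by rewrite ler_wpDl ?(ltW d0)// ler_pdivlMr// expr2 ler_wpM2l// ltW.
Qed.

(* The inequality |u| <= d + u^2 / d reduces the error to the variance of the binomial
   distribution. *)
Lemma bernstein_approx_error_lipschitz K L d n f t :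
  0 < K -> 0 <= L -> 0 < d -> (0 < n)%N ->
  L.-lipschitz_[set s | `|s| <= K] f -> `|t| <= K ->
  `|f t - (bernstein_approx K n f).[t]| <= L * (d + K ^+ 2 / (n%:R * d)).
Proof.
move=> K0 L0 d0 n0 Lf tK; have nR_gt0 : (0 : R) < n%:R by rewrite ltr0n.
have x01 := unit_coord_itv01 K0 tK.
rewrite horner_bernstein_approx; set x := (t + K) / (2 * K) in x01 *.
rewrite -[f t]mulr1 -(sum_bernstein_basis n x) mulr_sumr -sumrB.
apply: le_trans (ler_norm_sum _ _ _) _.
pose c := 4 * K ^+ 2 / (n%:R ^+ 2 * d).
apply: (@le_trans _ _ (\sum_(k < n.+1) L * (d * bernstein_basis n k x
    + c * ((k%:R - n%:R * x) ^+ 2 * bernstein_basis n k x)))).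
  apply: ler_sum => -[k /=]; rewrite ltnS => kn _.
  rewrite -mulrBl normrM (ger0_norm (bernstein_basis_ge0 n k x01)) mulrA -mulrDl mulrA.
  rewrite ler_wpM2r ?bernstein_basis_ge0//.
  apply: le_trans (Lf (t, _) (conj tK (normr_bernstein_node_le K0 kn))) _.
  rewrite ler_wpM2l//=; apply: le_trans (ler_norm_addr_sqr_div _ d0) _.
  rewrite subr_bernstein_node// -/x lerD2l le_eqVlt; apply/orP; left; apply/eqP.
  by rewrite /c; field; rewrite !gt_eqF.
rewrite -mulr_sumr ler_wpM2l// big_split/= -!mulr_sumr sum_bernstein_basis.
rewrite sum_sqr_bernstein_basis subrr expr0n/= addr0 mulr1 lerD2l.
have -> : c * (n%:R * x * (1 - x)) = 4 * (x * (1 - x)) * (K ^+ 2 / (n%:R * d)).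
  by rewrite /c; field; rewrite !gt_eqF.
rewrite ler_piMl ?divr_ge0 ?sqr_ge0 ?mulr_ge0 ?(ltW d0)//.
by rewrite -subr_ge0 (_ : _ - _ = (2 * x - 1) ^+ 2) ?sqr_ge0//; ring.
Qed.

Lemma normr_bernstein_approx_le K n f C t : 0 < K ->
  (forall s, `|s| <= K -> `|f s| <= C) -> K <= `|t| ->
  `|(bernstein_approx K n f).[t]| <= C * (`|t| / K) ^+ n.
Proof.
move=> K0 fC Kt; rewrite horner_bernstein_approx; set x := (t + K) / (2 * K).
have -> : `|t| / K = `|x| + `|1 - x|.
  have -> : 1 - x = (K - t) / (2 * K) by rewrite /x; field; rewrite gt_eqF.
  rewrite /x !normf_div -mulrDl [`|2 * K|]gtr0_norm ?mulr_gt0//.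
  have -> : `|t + K| + `|K - t| = 2 * `|t|; last by field; rewrite gt_eqF.
  case: (ler0P t) Kt => t0 Kt.
    by rewrite [`|t + K|]ler0_norm ?[`|K - t|]ger0_norm; [ring|lra|lra].
  by rewrite [`|t + K|]ger0_norm ?[`|K - t|]ler0_norm; [ring|lra|lra].
rewrite -sum_normr_bernstein_basis mulr_sumr; apply: le_trans (ler_norm_sum _ _ _) _.
apply: ler_sum => -[k /=]; rewrite ltnS => kn _.
by rewrite normrM ler_wpM2r// fC// normr_bernstein_node_le.
Qed.

(* The second term absorbs the error outside of [-K, K]; its exponent may be as large
   as one wishes, which makes it integrate to something small against a measure whose
   moments are nearly those of a measure on a strictly smaller interval. *)
Lemma bernstein_approx_error_even_growth K A eps n m q f t :
  0 < K -> (n <= m.*2)%N -> (q <= m)%N -> even_growth A q f ->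
  (forall s, `|s| <= K -> `|f s - (bernstein_approx K n f).[s]| <= eps) ->
  `|f t - (bernstein_approx K n f).[t]|
  <= eps + 2 * A * (1 + K ^+ q.*2) * (t / K) ^+ m.*2.
Proof.
move=> K0 nm qm fA feps; have A0 := even_growth_ge0 fA.
have AK0 : 0 <= A * (1 + K ^+ q.*2) by rewrite mulr_ge0// addr_ge0// exprn_double_ge0.
have eps0 : 0 <= eps by apply: le_trans (feps 0 _); rewrite ?normr0// ltW.
have [tK|/ltW Kt] := leP `|t| K.
  by rewrite ler_wpDr ?feps// mulr_ge0 ?exprn_double_ge0// -mulrA mulr_ge0.
have tK1 : 1 <= `|t| / K by rewrite ler_pdivlMr// mul1r.
rewrite ler_wpDl// (le_trans (ler_normB _ _))//.
rewrite -(normrX_double (t / K)) normf_div (gtr0_norm K0).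
rewrite -2!mulrA mulr2n mulrDl mul1r mulrA lerD//.
- apply: le_trans (fA t) _; rewrite -mulrA ler_wpM2l//.
  apply: (@le_trans _ _ ((1 + K ^+ q.*2) * (`|t| / K) ^+ q.*2)).
    rewrite mulrDl mul1r -exprMn [K * _]mulrC divfK ?gt_eqF// normrX_double lerD2r.
    by rewrite exprn_ege1.
  by rewrite ler_wpM2l ?addr_ge0 ?exprn_double_ge0// ler_weXn2l// leq_double.
- apply: le_trans (normr_bernstein_approx_le n K0 _ Kt) _.
    by move=> s; exact: even_growth_bounded fA.
  by rewrite ler_wpM2l// ler_weXn2l.
Qed.
End BernsteinApprox.

Lemma near_bernstein_approx_error (R : archiRealFieldType) (K L eps : R) :
  0 < K -> 0 < eps ->
  \forall n \near \oo, forall f, L.-lipschitz_[set s | `|s| <= K] f ->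
    forall t, `|t| <= K -> `|f t - (bernstein_approx K n f).[t]| <= eps.
Proof.
move=> K0 eps0; pose Lpos := `|L| + 1; have Lpos_gt0 : 0 < Lpos by rewrite ltr_wpDl.
pose d := eps / (2 * Lpos); have d0 : 0 < d by rewrite divr_gt0// mulr_gt0.
near=> n => f Lf t tK.
have n0 : (0 < n)%N by near: n; exact: nbhs_infty_gt.
have Lpos_f : Lpos.-lipschitz_[set s | `|s| <= K] f.
  move=> z zK; apply: le_trans (Lf z zK) _; rewrite ler_wpM2r//.
  by rewrite (le_trans (ler_norm L))// lerDl.
apply: le_trans (bernstein_approx_error_lipschitz K0 (ltW Lpos_gt0) d0 n0 Lpos_f tK) _.
have -> : eps = Lpos * (d + d) by rewrite /d; field; rewrite gt_eqF.
rewrite ler_pM2l// lerD2l ler_pdivrMr; last by apply: mulr_gt0; rewrite ?ltr0n.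
rewrite mulrCA -expr2 -ler_pdivrMr ?exprn_gt0//.
by apply: ltW; near: n; exact: nbhs_infty_gtr.
Unshelve. all: by end_near. Qed.

(** * Measures with bounded support *)

Lemma probability_Rintegral_cst d (T : measurableType d) (R : realType)
    (P : probability T R) (r : R) : \int[P]_t r = r.
Proof. by rewrite Rintegral_cst// [X in fine X]probability_setT mulr1. Qed.

Section BoundedSupport.
Context {R : realType}.
Implicit Types (mu : probability R R) (M C : R) (f h : R -> R).

Lemma negligible_msupportC mu : mu.-negligible (~` msupport mu).
Proof.
pose I (pq : rat * rat) : set R := `]ratr pq.1, ratr pq.2[%classic.
pose N (n : nat) : set R :=
  if unpickle n is Some pq then if mu (I pq) == 0%E then I pq else set0 else set0.
have N0 n : mu.-negligible (N n).
  rewrite /N; case: unpickle => [pq|]; last exact: negligible_set0.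
  case: ifPn => [/eqP pq0|_]; last exact: negligible_set0.
  by exists (I pq); split => //; exact: measurable_itv.
apply: negligibleS (negligible_bigcup N0) => x /existsNP[r /not_implyP[r0]].
move/negP; rewrite -leNgt measure_le0 => /eqP xr0.
have [p] := @rat_in_itvoo R (x - r) x ltac:(lra).
have [q] := @rat_in_itvoo R x (x + r) ltac:(lra).
rewrite !in_itv/= => /andP[xq qr] /andP[rp px].
have pq0 : mu (I (p, q)) = 0%E.
  apply/eqP; rewrite -measure_le0 -xr0 le_measure ?inE//=.
  - exact: measurable_itv.
  - exact: measurable_ball.
  move=> y; rewrite /I/= in_itv/= => /andP[py yq].
  by rewrite /ball/= ltr_norml; apply/andP; split; lra.
have [n NE] : exists n, N n = I (p, q).
  by exists (pickle (p, q)); rewrite /N pickleK pq0 eqxx.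
by exists n => //; rewrite NE /I/= in_itv/= px.
Qed.

Lemma msupport_itvC_eq0 mu M : msupport mu `<=` `[- M, M] ->
  mu (~` `[- M, M]%classic) = 0%E.
Proof.
move=> muM; apply/negligibleP; first by apply: measurableC; exact: measurable_itv.
by apply: negligibleS (negligible_msupportC mu); exact: subsetC.
Qed.

Lemma msupport_integrable mu M f C : msupport mu `<=` `[- M, M] ->
  measurable_fun setT f -> (forall t, `|t| <= M -> `|f t| <= C) ->
  mu.-integrable setT (EFin \o f).
Proof.
move=> muM mf fC; have mI := measurable_itv `[- M, M].
apply/(negligible_integrable (measurableC mI)) => //; first exact/measurable_EFinP.
  exact: msupport_itvC_eq0.
rewrite setDE setCK setTI.
apply: (@le_integrable _ _ _ _ _ _ _ (EFin \o cst C)) => //.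
- by apply: measurable_funTS; exact/measurable_EFinP.
- move=> t /=; rewrite in_itv/= -ler_norml => /fC fCt.
  by rewrite lee_fin (le_trans fCt)// ler_norm.
- exact: finite_measure_integrable_cst.
Qed.

Lemma msupport_le_Rintegral mu M f h : msupport mu `<=` `[- M, M] ->
  mu.-integrable setT (EFin \o f) -> mu.-integrable setT (EFin \o h) ->
  (forall t, `|t| <= M -> f t <= h t) -> \int[mu]_t f t <= \int[mu]_t h t.
Proof.
move=> muM intf inth fh; have mI := measurable_itv `[- M, M].
have restrict e : mu.-integrable setT (EFin \o e) ->
    \int[mu]_t e t = \int[mu]_(t in `[- M, M]) e t.
  move=> inte; rewrite /Rintegral (negligible_integral (measurableC mI)) ?setDE//.
    by rewrite setCK setTI.
  exact: msupport_itvC_eq0.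
rewrite !restrict// le_Rintegral//.
- exact: integrableS intf.
- exact: integrableS inth.
- by move=> t /=; rewrite in_itv/= -ler_norml => /fh.
Qed.

Lemma msupport_finite_moments mu M : msupport mu `<=` `[- M, M] -> finite_moments mu.
Proof.
move=> muM k; apply: (msupport_integrable (C := M ^+ k) muM).
- exact: exprn_measurable.
- by move=> t tM; rewrite normrX lerXn2r ?nnegrE// (le_trans _ tM).
Qed.

Lemma msupport_even_moment_le mu M m : msupport mu `<=` `[- M, M] ->
  moment mu m.*2 <= M ^+ m.*2.
Proof.
move=> muM; rewrite -[leRHS](probability_Rintegral_cst mu).
apply: (msupport_le_Rintegral muM).
- exact: msupport_finite_moments muM _.
- exact: finite_measure_integrable_cst.
- by move=> t tM; rewrite -normrX_double lerXn2r ?nnegrE// (le_trans _ tM).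
Qed.
End BoundedSupport.

(** * Merging of moments *)

Lemma cvg_sum0 (V : topologicalZmodType) (T I : Type) (F : set_system T) (r : seq I)
    (u : I -> T -> V) : Filter F ->
  (forall i, u i @ F --> 0) -> (fun x => \sum_(i <- r) u i x) @ F --> 0.
Proof.
move=> FF u0; rewrite [X in _ --> X](_ : 0 = \sum_(i <- r) 0); last by rewrite big1.
by apply: (cvg_big (Fa := fun=> 0) add_continuous) => i _; exact: u0.
Qed.

Lemma Rintegral_sum d (T : measurableType d) (R : realType)
    (mu : {measure set T -> \bar R}) (D : set T) (I : Type) (r : seq I) (F : I -> T -> R) :
  measurable D -> (forall i, mu.-integrable D (EFin \o F i)) ->
  \int[mu]_(x in D) (\sum_(i <- r) F i x) = \sum_(i <- r) \int[mu]_(x in D) F i x.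
Proof.
move=> mD intF; rewrite /Rintegral; under eq_integral do rewrite -sumEFin.
rewrite integral_sum// -sum_fine// => i _; apply: integrable_fin_num => //.
exact: intF.
Qed.

Section MomentsMerge.
Context {R : realType}.
Implicit Types (mu : probability R R) (nu nub : nat -> probability R R).
Implicit Types (p : {poly R}) (f : R -> R) (A C K L M eps : R) (m n q : nat).

Lemma integrable_horner mu p : finite_moments mu ->
  mu.-integrable setT (fun t => (p.[t])%:E).
Proof.
move=> hmu; under eq_fun do rewrite horner_coef -sumEFin.
apply: integrable_sum => // i _; under eq_fun do rewrite EFinM.
exact: integrableZl.
Qed.

Lemma Rintegral_horner mu p : finite_moments mu ->
  \int[mu]_t p.[t] = \sum_(i < size p) p`_i * moment mu i.
Proof.
move=> hmu; under eq_Rintegral do rewrite horner_coef.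
rewrite Rintegral_sum// => [|i]; last first.
  by under [_ \o _]eq_fun do rewrite /= EFinM; exact: integrableZl.
by apply: eq_bigr => i _; rewrite RintegralZl//; exact: hmu.
Qed.

Definition moments_merge nu nub := forall k : nat,
  (fun d => `|moment (nu d) k - moment (nub d) k|) @ \oo --> (0 : R).

Lemma moments_merge_refl nu : moments_merge nu nu.
Proof. by move=> k; under eq_fun do rewrite subrr normr0; exact: cvg_cst. Qed.

Lemma moments_merge_horner nu nub p : moments_merge nu nub ->
  (forall d, finite_moments (nu d)) -> (forall d, finite_moments (nub d)) ->
  (fun d => `|\int[nu d]_t p.[t] - \int[nub d]_t p.[t]|) @ \oo --> (0 : R).
Proof.
move=> merge hnu hnub; apply/norm_cvg0P.
have -> : (fun d => \int[nu d]_t p.[t] - \int[nub d]_t p.[t])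
    = (fun d => \sum_(i < size p) p`_i * (moment (nu d) i - moment (nub d) i)).
  apply/funext => d; rewrite !Rintegral_horner// -sumrB.
  by apply: eq_bigr => i _; rewrite mulrBr.
apply: (@cvg_sum0 R _ _ _ _ (fun (i : 'I_(size p)) d =>
  p`_i * (moment (nu d) i - moment (nub d) i))) => i.
by rewrite -[X in _ --> X](mulr0 p`_i); apply: cvgMr; apply/norm_cvg0P; exact: merge.
Qed.

Lemma Rintegral_bernstein_approx mu K n f : finite_moments mu ->
  \int[mu]_t (bernstein_approx K n f).[t] = \sum_(k < n.+1) f (bernstein_node K n k)
    * \int[mu]_t (bernstein_basis n k (unit_coord K)).[t].
Proof.
move=> hmu; under eq_Rintegral do rewrite horner_sum.
under eq_Rintegral do under eq_bigr do rewrite hornerZ.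
rewrite Rintegral_sum// => [|k].
  by apply: eq_bigr => k _; rewrite RintegralZl//; exact: integrable_horner.
under [_ \o _]eq_fun do rewrite /= EFinM; apply: integrableZl => //.
exact: integrable_horner.
Qed.

Lemma moments_merge_bernstein_approx nu nub K C n eps : moments_merge nu nub ->
  (forall d, finite_moments (nu d)) -> (forall d, finite_moments (nub d)) ->
  0 < K -> 0 < eps -> \forall d \near \oo, forall f,
    (forall s, `|s| <= K -> `|f s| <= C) ->
    `|\int[nu d]_t (bernstein_approx K n f).[t]
      - \int[nub d]_t (bernstein_approx K n f).[t]| <= eps.
Proof.
move=> merge hnu hnub K0 eps0.
pose b k := bernstein_basis n k (unit_coord K).
pose u k d := C * `|\int[nu d]_t (b k).[t] - \int[nub d]_t (b k).[t]|.
have u0 k : u k @ \oo --> (0 : R).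
  by rewrite -[X in _ --> X](mulr0 C); apply: cvgMr; exact: moments_merge_horner.
have /cvgr0Pnorm_le/(_ _ eps0) : (fun d => \sum_(k < n.+1) u k d) @ \oo --> (0 : R).
  by apply: (@cvg_sum0 R) => k; exact: u0.
apply: filterS => d ud f fC; rewrite !Rintegral_bernstein_approx// -sumrB.
apply: le_trans ud; apply: le_trans (ler_norm _); apply: le_trans (ler_norm_sum _ _ _) _.
apply: ler_sum => -[k /=]; rewrite ltnS => kn _.
by rewrite -mulrBr normrM ler_wpM2r// fC// normr_bernstein_node_le.
Qed.

Lemma near_even_moment_ratio nu nub M K eps : moments_merge nu nub ->
  (forall d, msupport (nub d) `<=` `[- M, M]) -> 0 < M -> M < K -> 0 < eps ->
  \forall m \near \oo, \forall d \near \oo, moment (nu d) m.*2 / K ^+ m.*2 <= eps.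
Proof.
move=> merge nubM M0 MK eps0; have K0 : 0 < K by exact: lt_trans MK.
have e2 : 0 < eps / 2 by rewrite divr_gt0.
have MK1 : `|(M / K) ^+ 2| < 1.
  rewrite ger0_norm ?sqr_ge0// expr_lt1 ?divr_ge0 ?(ltW M0) ?(ltW K0)//.
  by rewrite ltr_pdivrMr// mul1r.
have /cvgr0Pnorm_le/(_ _ e2) := cvg_expr MK1.
apply: filterS => m /=; rewrite -exprM mul2n expr_div_n => /(le_trans (ler_norm _)) Mm.
have Km : 0 < K ^+ m.*2 by rewrite exprn_gt0.
have /cvgr0Pnorm_le/(_ _ (mulr_gt0 e2 Km)) := merge m.*2.
apply: filterS => d /=; rewrite normr_id => /(le_trans (ler_norm _)) close.
rewrite [eps]splitr ler_pdivrMr// mulrDl; move: Mm; rewrite ler_pdivrMr//.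
by have := msupport_even_moment_le m (nubM d); lra.
Qed.

Lemma integrable_even_growth mu f A q : finite_moments mu -> measurable_fun setT f ->
  even_growth A q f -> mu.-integrable setT (EFin \o f).
Proof.
move=> hmu mf fA.
apply: (@le_integrable _ _ _ _ _ _ _ (fun t => (A *: (1 + 'X^(q.*2))).[t]%:E)) => //.
- exact/measurable_EFinP.
- by move=> t _ /=; rewrite lee_fin !hornerE (le_trans (fA t))// ler_norm.
- exact: integrable_horner.
Qed.

Lemma Rintegral_bernstein_approx_error mu f A K eps m n q :
  finite_moments mu -> measurable_fun setT f -> even_growth A q f ->
  0 < K -> (n <= m.*2)%N -> (q <= m)%N ->
  (forall s, `|s| <= K -> `|f s - (bernstein_approx K n f).[s]| <= eps) ->
  `|\int[mu]_t f t - \int[mu]_t (bernstein_approx K n f).[t]|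
  <= eps + 2 * A * (1 + K ^+ q.*2) * (moment mu m.*2 / K ^+ m.*2).
Proof.
move=> hmu mf fA K0 nm qm feps; set D := 2 * A * _; set B := bernstein_approx K n f.
have intf := integrable_even_growth hmu mf fA.
have intB : mu.-integrable setT (EFin \o horner B) by exact: integrable_horner.
have intfB : mu.-integrable setT (EFin \o (fun t => f t - B.[t])).
  by have := integrableB measurableT intf intB.
pose bound : {poly R} := eps%:P + (D / K ^+ m.*2) *: 'X^(m.*2).
have boundE t : bound.[t] = eps + D / K ^+ m.*2 * t ^+ m.*2 by rewrite !hornerE.
have intX : mu.-integrable setT (EFin \o (fun t => t ^+ m.*2)) by exact: hmu.
have -> : eps + D * (moment mu m.*2 / K ^+ m.*2) = \int[mu]_t bound.[t].
  under eq_Rintegral do rewrite boundE.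
  rewrite RintegralD//; last 2 first.
  - exact: finite_measure_integrable_cst.
  - by under [_ \o _]eq_fun do rewrite /= EFinM; exact: integrableZl.
  rewrite probability_Rintegral_cst RintegralZl//; congr (_ + _).
  by rewrite mulrCA mulrC.
rewrite -RintegralB//; apply: le_trans (le_normr_Rintegral measurableT intfB) _.
apply: le_Rintegral => //; first exact: integrable_norm.
  exact: integrable_horner.
move=> t _; rewrite boundE mulrAC -mulrA -expr_div_n.
exact: bernstein_approx_error_even_growth.
Qed.

Lemma moments_merge_Rintegral nu nub M K L A q eps : moments_merge nu nub ->
  (forall d, finite_moments (nu d)) -> (forall d, msupport (nub d) `<=` `[- M, M]) ->
  0 < M -> M < K -> 0 < eps ->
  \forall d \near \oo, forall f, measurable_fun setT f ->
    L.-lipschitz_[set s | `|s| <= K] f -> even_growth A q f ->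
    `|\int[nu d]_t f t - \int[nub d]_t f t| <= eps.
Proof.
move=> merge hnu nubM M0 MK eps0; have K0 : 0 < K by exact: lt_trans MK.
have hnub d : finite_moments (nub d) by exact: msupport_finite_moments (nubM d).
pose e := eps / 5; have e0 : 0 < e by rewrite divr_gt0.
pose D := 2 * A * (1 + K ^+ q.*2); pose Dpos := `|D| + 1.
have Dpos_gt0 : 0 < Dpos by rewrite ltr_wpDl.
have tail mu m : 0 <= A -> moment mu m.*2 / K ^+ m.*2 <= e / Dpos ->
    D * (moment mu m.*2 / K ^+ m.*2) <= e.
  move=> A0 /(ler_wpM2l _) le_D; have D0 : 0 <= D.
    by rewrite mulr_ge0 ?addr_ge0 ?exprn_double_ge0// mulr_ge0.
  rewrite (le_trans (le_D _ D0))// mulrCA ger_pMr// ler_pdivrMr// mul1r.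
  by rewrite /Dpos (ger0_norm D0) lerDl.
have [n approx] := filter_ex (near_bernstein_approx_error L K0 e0).
have eD_gt0 : 0 < e / Dpos by rewrite divr_gt0.
near \oo => m.
have nm : (n <= m.*2)%N.
  rewrite (@leq_trans m) -?addnn ?leq_addr//.
  by near: m; exact: nbhs_infty_ge.
have qm : (q <= m)%N by near: m; exact: nbhs_infty_ge.
have nu_tail : \forall d \near \oo, moment (nu d) m.*2 / K ^+ m.*2 <= e / Dpos.
  by near: m; exact: near_even_moment_ratio merge nubM M0 MK eD_gt0.
have nub_tail : \forall d \near \oo, moment (nub d) m.*2 / K ^+ m.*2 <= e / Dpos.
  by near: m; exact: near_even_moment_ratio (moments_merge_refl nub) nubM M0 MK eD_gt0.
have := moments_merge_bernstein_approx (A * (1 + K ^+ q.*2)) n merge hnu hnub K0 e0.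
apply: filterS3 nu_tail nub_tail => d nu_d nub_d merge_d f mf Lf fA.
have A0 := even_growth_ge0 fA; have approxf := approx f Lf.
have := Rintegral_bernstein_approx_error (hnub d) mf fA K0 nm qm approxf.
have := Rintegral_bernstein_approx_error (hnu d) mf fA K0 nm qm approxf.
have := merge_d f (fun s => even_growth_bounded fA).
have := tail _ _ A0 nub_d; have := tail _ _ A0 nu_d; rewrite -/D.
have -> : eps = e + e + e + e + e by rewrite /e; field.
rewrite !ler_norml => ? ? /andP[? ?] /andP[? ?] /andP[? ?].
by apply/andP; split; lra.
Unshelve. all: by end_near. Qed.
End MomentsMerge.

(** * The Poisson kernel *)

Section PoissonKernel.
Context {R : realType}.
Variable g : R.
Hypothesis g_gt0 : 0 < g.
Implicit Types (mu : probability R R) (h x y s t K M : R).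

Lemma sqrDsqr_gt0 x : 0 < x ^+ 2 + g ^+ 2.
Proof. by rewrite ltr_wpDl ?sqr_ge0// exprn_gt0. Qed.

Lemma Poisson_gt0 x : 0 < Poisson g x.
Proof. by rewrite divr_gt0// mulr_gt0 ?pi_gt0// sqrDsqr_gt0. Qed.

Lemma Poisson_le x : Poisson g x <= (pi * g)^-1.
Proof.
rewrite /Poisson; move: (@pi R) (pi_gt0 R) => p p0.
have -> : (p * g)^-1 = g / (p * g ^+ 2) by field; rewrite !gt_eqF.
rewrite ler_pM2l// lef_pV2 ?posrE ?mulr_gt0 ?sqrDsqr_gt0 ?exprn_gt0//.
by rewrite ler_pM2l// lerDr sqr_ge0.
Qed.

Lemma normrM_Poisson (a x : R) : `|a * Poisson g x| = `|a| * Poisson g x.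
Proof. by rewrite normrM [X in _ * X]gtr0_norm// Poisson_gt0. Qed.

Definition Harnack x : R := 1 + `|x| / g + (`|x| / g) ^+ 2.

Lemma HarnackN x : Harnack (- x) = Harnack x.
Proof. by rewrite /Harnack normrN. Qed.

Lemma Harnack_ge1 x : 1 <= Harnack x.
Proof. by rewrite /Harnack -addrA lerDl addr_ge0 ?sqr_ge0// divr_ge0// ltW. Qed.

Lemma Harnack_gt0 x : 0 < Harnack x.
Proof. exact: lt_le_trans (Harnack_ge1 x). Qed.

Lemma Harnack_le x y : `|x| <= `|y| -> Harnack x <= Harnack y.
Proof.
move=> xy; have h : `|x| / g <= `|y| / g by rewrite ler_pM2r ?invr_gt0.
by rewrite lerD ?lerD2l// lerXn2r// nnegrE divr_ge0// ltW.
Qed.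

Lemma Harnack_sub1_le h x : `|x| <= h -> Harnack x - 1 <= g^-1 * (1 + h / g) * `|x|.
Proof.
move=> xh; have -> : Harnack x - 1 = g^-1 * (1 + `|x| / g) * `|x|.
  by rewrite /Harnack; ring.
by rewrite ler_wpM2r// ler_pM2l ?invr_gt0// lerD2l ler_pM2r ?invr_gt0.
Qed.

Lemma Harnack_even_growth : even_growth (1 + g^-1 + g ^- 2) 1 Harnack.
Proof.
move=> t; rewrite gtr0_norm ?Harnack_gt0// /Harnack exprMn -[t ^+ _]real_normK ?num_real//.
rewrite -exprVn; have gi0 : 0 <= g^-1 by rewrite invr_ge0 ltW.
have := normr_ge0 t; move: `|t| g^-1 gi0 => u k k0 u0.
have := ler_wpM2r k0 (_ : u <= 1 + u ^+ 2); have := sqr_ge0 u; have := sqr_ge0 k.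
by have := sqr_ge0 (u - 1); nra.
Qed.

Lemma continuous_Harnack : continuous Harnack.
Proof.
move=> x; have normg : `|y| / g @[y --> x] --> `|x| / g.
  by apply: cvgMl; exact: norm_continuous.
apply: cvgD; last exact: (cvgM normg normg).
by apply: cvgD => //; exact: cvg_cst.
Qed.

(* With h = |x - y| / g, the inequality 2 |y| g <= y^2 + g^2 gives
   x^2 + g^2 <= (1 + h + h^2) (y^2 + g^2). *)
Lemma Poisson_Harnack x y : Poisson g y <= Harnack (x - y) * Poisson g x.
Proof.
rewrite /Poisson; move: (@pi R) (pi_gt0 R) => p p0.
have xg_gt0 := sqrDsqr_gt0 x; have yg_gt0 := sqrDsqr_gt0 y.
rewrite mulrCA ler_pM2l// !invfM mulrCA ler_pM2l ?invr_gt0//.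
rewrite ler_pdivlMr// ler_pdivrMl// /Harnack; set h := `|x - y| / g.
have h0 : 0 <= h by rewrite divr_ge0// ltW.
have xyE : `|x - y| = h * g by rewrite /h divfK// gt_eqF.
have x2_le : x ^+ 2 <= y ^+ 2 + 2 * `|y| * (h * g) + (h * g) ^+ 2.
  rewrite -{2}xyE -{1}xyE real_normK ?num_real// -subr_ge0.
  have -> : y ^+ 2 + 2 * `|y| * `|x - y| + (x - y) ^+ 2 - x ^+ 2
    = 2 * (`|y| * `|x - y| - y * (x - y)) by ring.
  by rewrite mulr_ge0// subr_ge0 -normrM ler_norm.
have yg : 2 * `|y| * g <= y ^+ 2 + g ^+ 2.
  by have := sqr_ge0 (`|y| - g); rewrite sqrrB real_normK ?num_real//; lra.
have : 0 <= h * (y ^+ 2 + g ^+ 2 - 2 * `|y| * g) by rewrite mulr_ge0// subr_ge0.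
have : 0 <= h ^+ 2 * y ^+ 2 by rewrite mulr_ge0 ?sqr_ge0.
lra.
Qed.

Lemma Poisson_dist x y :
  `|Poisson g y - Poisson g x| <= (Harnack (x - y) - 1) * Poisson g x.
Proof.
have := Poisson_Harnack x y; have := Poisson_Harnack y x.
rewrite -[y - x]opprB HarnackN; have := Harnack_ge1 (x - y).
have := Poisson_gt0 x; have := Poisson_gt0 y.
move: (Poisson g x) (Poisson g y) (Harnack _) => a b q b0 a0 q1 ab ba.
by rewrite ler_norml; apply/andP; split; nra.
Qed.

Definition Poisson_lower_cst M : R := g / (pi * ((1 + M) ^+ 2 + g ^+ 2)).

Lemma Poisson_lower_cst_gt0 M : 0 < Poisson_lower_cst M.
Proof. by rewrite divr_gt0// mulr_gt0 ?pi_gt0// sqrDsqr_gt0. Qed.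

Lemma Poisson_lower_bound M x t : `|t| <= M ->
  Poisson_lower_cst M / (1 + `|x|) ^+ 2 <= Poisson g (x - t).
Proof.
move=> tM; have M0 : 0 <= M by exact: le_trans tM.
rewrite /Poisson_lower_cst /Poisson; move: (@pi R) (pi_gt0 R) => p p0.
have x0 := normr_ge0 x; have x1 : 1 <= (1 + `|x|) ^+ 2 by rewrite exprn_ege1// lerDl.
have x1_gt0 := lt_le_trans ltr01 x1.
rewrite -mulrA ler_pM2l// -invfM lef_pV2 ?posrE ?mulr_gt0 ?sqrDsqr_gt0//.
rewrite -mulrA ler_pM2l// mulrDl -exprMn lerD//; last by rewrite ler_peMr// sqr_ge0.
rewrite -[leLHS]real_normK ?num_real// lerXn2r ?nnegrE ?mulr_ge0 ?addr_ge0//.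
by have := ler_normB x t; nra.
Qed.

Definition Poisson_upper_cst : R := 2 * g * (1 + g ^- 2) / pi.

Lemma Poisson_upper_bound x : Poisson g x <= Poisson_upper_cst / (1 + `|x|) ^+ 2.
Proof.
rewrite /Poisson_upper_cst /Poisson; move: (@pi R) (pi_gt0 R) => p p0.
have x1 : 0 < (1 + `|x|) ^+ 2 by rewrite exprn_gt0// ltr_wpDr.
have xg_gt0 := sqrDsqr_gt0 x.
rewrite ler_pdivlMr// [leLHS](_ : _ = g / p * ((1 + `|x|) ^+ 2 / (x ^+ 2 + g ^+ 2)));
  last first.
  by field; rewrite !gt_eqF.
rewrite [leRHS](_ : _ = g / p * (2 * (1 + g ^- 2))); last by ring.
rewrite ler_pM2l ?divr_gt0// ler_pdivrMr//.
have gVg : g ^- 2 * g ^+ 2 = 1 by rewrite mulVf// gt_eqF// exprn_gt0.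
have : 0 <= g ^- 2 * `|x| ^+ 2 by rewrite mulr_ge0 ?sqr_ge0// invr_ge0 sqr_ge0.
rewrite -[x ^+ 2]real_normK ?num_real//; have := sqr_ge0 (1 - `|x|).
have -> : 2 * (1 + g ^- 2) * (`|x| ^+ 2 + g ^+ 2)
  = 2 * (`|x| ^+ 2 + g ^+ 2 + g ^- 2 * `|x| ^+ 2 + g ^- 2 * g ^+ 2) by ring.
by rewrite gVg; have := sqr_ge0 g; nra.
Qed.

Lemma measurable_Poisson : measurable_fun setT (Poisson g).
Proof.
apply: continuous_measurable_fun => x; apply: cvgMr; apply: cvgV.
  by rewrite gt_eqF// mulr_gt0 ?pi_gt0// sqrDsqr_gt0.
apply: cvgMr; apply: cvgD; last exact: cvg_cst.
exact: exprn_continuous.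
Qed.

Lemma measurable_PoissonB d (T : measurableType d) (u v : T -> R) :
  measurable_fun setT u -> measurable_fun setT v ->
  measurable_fun setT (fun z => Poisson g (u z - v z)).
Proof.
by move=> mu mv; apply: measurableT_comp measurable_Poisson _; exact: measurable_funB.
Qed.

Lemma integrable_Poisson mu x : mu.-integrable setT (EFin \o (fun t => Poisson g (x - t))).
Proof.
apply: (@le_integrable _ _ _ _ _ _ _ (EFin \o cst (pi * g)^-1)) => //.
- by apply/measurable_EFinP; exact: measurable_PoissonB.
- move=> t _ /=; rewrite lee_fin gtr0_norm ?Poisson_gt0//.
  by rewrite (le_trans (Poisson_le _))// ler_norm.
- exact: finite_measure_integrable_cst.
Qed.

Lemma measurable_Pconv mu : measurable_fun setT (Pconv g mu).
Proof.
apply: measurableT_comp => //.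
apply: (@measurable_fun_fubini_tonelli_F _ _ _ _ _ mu
  (fun z : R * R => (Poisson g (z.1 - z.2))%:E)).
- by apply/measurable_EFinP; exact: measurable_PoissonB.
- by move=> z; rewrite lee_fin ltW// Poisson_gt0.
Qed.

Lemma ellE x mu : ell g x mu = - ln (Pconv g mu x).
Proof.
rewrite /ell; congr (- ln _).
have -> : ImG mu (x +i* g)%C = \int[mu]_t (- pi * Poisson g (x - t)).
  apply: eq_Rintegral => t _ /=.
  rewrite /Poisson subr0; move: (@pi R) (pi_gt0 R) => p p0.
  by field; rewrite !gt_eqF ?sqrDsqr_gt0.
rewrite RintegralZl//; last exact: integrable_Poisson.
by rewrite mulrA mulrNN mulVf ?mul1r// gt_eqF// pi_gt0.
Qed.

Lemma measurable_ell mu : measurable_fun setT (fun x => ell g x mu).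
Proof.
under eq_fun do rewrite ellE; apply: measurableT_comp => //.
by apply: measurableT_comp => //; exact: measurable_Pconv.
Qed.
End PoissonKernel.

(** * The logarithmic potential *)

Section PowerIntegrals.
Context {R : realType}.
Implicit Types p x y : R.
Local Notation leb := (@lebesgue_measure R).

Lemma ln_le_powR p y : 0 < p -> 0 < y -> ln y <= p^-1 * y `^ p.
Proof.
move=> p0 y0; rewrite ler_pdivlMl// -ln_powR.
by apply: ltW; apply: ln_sublinear; exact: powR_gt0.
Qed.

Lemma continuous_powR_1Dnorm p : continuous (fun x : R => (1 + `|x|) `^ p).
Proof.
move=> x; have x0 : 0 < 1 + `|x| by rewrite ltr_wpDr.
apply: (@continuous_comp _ _ _ (fun x : R => 1 + `|x|) (fun a => a `^ p)).
  by apply: cvgD; [exact: cvg_cst|exact: norm_continuous].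
apply: differentiable_continuous; apply/derivable1_diffP.
by apply: derivable_powR; rewrite in_itv/= x0.
Qed.

Lemma is_derive_powR_1D p x : 0 <= x ->
  is_derive x 1 (fun x => (1 + x) `^ p) (p * (1 + x) `^ (p - 1)).
Proof.
move=> x0; have x1 : 0 < 1 + x by rewrite ltr_pwDl.
have d1D : is_derive x 1 (fun x : R => 1 + x) 1.
  apply: (is_derive_eq (is_deriveD (is_derive_cst (1 : R) x 1) (is_derive_id x 1))).
  exact: add0r.
by apply: (is_derive_eq (is_derive1_comp (is_derive1_powR p x1) d1D)); rewrite mulr1.
Qed.

Lemma cvg_powR_1D_pinfty p : p < 0 -> (1 + x) `^ p @[x --> +oo] --> (0 : R).
Proof.
move=> p0; apply/cvgr0Pnorm_le => e e0; near=> x.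
have xe : e `^ p^-1 <= 1 + x.
  apply: (@le_trans _ _ x); last by rewrite lerDr.
  by near: x; apply: nbhs_pinfty_ge; exact: num_real.
have eE : e = (e `^ p^-1) `^ p by rewrite -powRrM mulVf ?powRr1 ?(ltW e0)// lt_eqF.
have c0 : 0 < e `^ p^-1 by exact: powR_gt0.
have x0 : 0 < 1 + x by exact: lt_le_trans xe.
rewrite ger0_norm ?powR_ge0// eE.
move: (e `^ _) c0 xe => c c0 cx; rewrite -[p]opprK !(powRN _ (- p)).
rewrite lef_pV2 ?posrE ?powR_gt0//.
by apply: ge0_ler_powR; rewrite ?nnegrE ?oppr_ge0 ?(ltW p0) ?(ltW c0) ?(ltW x0).
Unshelve. all: by end_near. Qed.

Lemma integral_powR_1Dnorm_half_line p : p < -1 ->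
  (\int[leb]_(x in `[0%R, +oo[) ((1 + `|x|) `^ p)%:E = (- (p + 1)^-1)%:E)%E.
Proof.
move=> p1; have q0 : p + 1 < 0 by rewrite -ltrBrDr sub0r.
pose F x : R := (p + 1)^-1 * (1 + x) `^ (p + 1).
have dF x : 0 <= x -> is_derive x 1 F ((1 + `|x|) `^ p).
  move=> x0; apply: (is_derive_eq (is_deriveZ (p + 1)^-1 (is_derive_powR_1D (p + 1) x0))).
  by rewrite addrK ger0_norm// /GRing.scale/= mulrA mulVf ?mul1r// lt_eqF.
rewrite (@ge0_continuous_FTC2y _ _ F 0 0)//.
- by rewrite /F addr0 powR1 mulr1 sub0e EFinN.
- by apply: continuous_subspaceT; exact: continuous_powR_1Dnorm.
- rewrite -[X in _ --> X](mulr0 (p + 1)^-1); apply: cvgMr; exact: cvg_powR_1D_pinfty.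
- by move=> x /ltW x0; have [] := dF x x0.
- apply: cvg_at_right_filter; apply: differentiable_continuous.
  by apply/derivable1_diffP; have [] := dF 0 (lexx _).
- move=> x; rewrite in_itv/= andbT => /ltW x0; rewrite derive1E.
  by have [_ ->] := dF x x0.
Qed.

Lemma integrable_powR_1Dnorm p : p < -1 ->
  leb.-integrable setT (fun x : R => ((1 + `|x|) `^ p)%:E).
Proof.
move=> p1; apply/integrableP; split.
  apply/measurable_EFinP; apply: continuous_measurable_fun.
  exact: continuous_powR_1Dnorm.
under eq_integral do rewrite gee0_abs ?lee_fin ?powR_ge0//.
rewrite ge0_symfun_integralT//.
- by rewrite -set_itvcy integral_powR_1Dnorm_half_line// ltry.
- exact: continuous_powR_1Dnorm.
- by move=> x /=; rewrite normrN.
Qed.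
End PowerIntegrals.

Section LogPotential.
Context {R : realType}.
Variables (g M : R).
Hypothesis g_gt0 : 0 < g.
Implicit Types (mu : probability R R) (x : R).
Local Notation leb := (@lebesgue_measure R).

Lemma Pconv_bounds mu x : BM M mu ->
  Poisson_lower_cst g M / (1 + `|x|) ^+ 2 <= Pconv g mu x <= (pi * g)^-1.
Proof.
move=> muM; have intP := integrable_Poisson g_gt0 mu x.
have cstE C : C = \int[mu]_t C by rewrite probability_Rintegral_cst.
apply/andP; split; [rewrite [leLHS]cstE|rewrite [leRHS]cstE];
  apply: (msupport_le_Rintegral muM) => //;
  try exact: finite_measure_integrable_cst.
  by move=> t; exact: Poisson_lower_bound.
by move=> t _; exact: Poisson_le.
Qed.

Lemma ell_sqrt_growth : exists B : R, forall mu x, BM M mu ->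
  `|ell g x mu| <= B * (1 + `|x|) `^ 2^-1.
Proof.
pose c := Poisson_lower_cst g M; pose C := (pi * g)^-1.
exists (4 + `|ln c| + `|ln C|) => mu x muM; rewrite ellE// normrN.
have x1 : 1 <= 1 + `|x| by rewrite lerDl.
have x0 : 0 < 1 + `|x| by exact: lt_le_trans x1.
have /andP[lower upper] := Pconv_bounds x muM.
have c0 : 0 < c by exact: Poisson_lower_cst_gt0.
have cx0 : 0 < c / (1 + `|x|) ^+ 2 by rewrite divr_gt0// exprn_gt0.
have P0 : 0 < Pconv g mu x by exact: lt_le_trans lower.
have ln_lower : ln c - ln (1 + `|x|) *+ 2 <= ln (Pconv g mu x).
  by rewrite -lnXn// -ln_div ?posrE ?exprn_gt0// ler_ln ?posrE.
have ln_upper : ln (Pconv g mu x) <= ln C.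
  by rewrite ler_ln ?posrE// (lt_le_trans P0).
have half_gt0 : 0 < 2^-1 :> R by rewrite invr_gt0.
have := ln_le_powR half_gt0 x0; rewrite invrK => ln_sqrt.
have sqrt_ge1 : 1 <= (1 + `|x|) `^ 2^-1.
  by rewrite -[leLHS](powRr0 (1 + `|x|)) ler_powR// invr_ge0.
have lnc : `|ln c| <= `|ln c| * (1 + `|x|) `^ 2^-1 by rewrite ler_peMr.
have lnC : `|ln C| <= `|ln C| * (1 + `|x|) `^ 2^-1 by rewrite ler_peMr.
have := ler_norm (- ln c); have := ler_norm (ln C); rewrite normrN => ? ?.
have := normr_ge0 (ln c); have := normr_ge0 (ln C) => ? ?.
by rewrite ler_norml; apply/andP; split; lra.
Qed.

Lemma ell_Poisson_L1_bounded : exists A : R, forall mu, BM M mu ->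
  (\int[leb]_x `|ell g x mu * Poisson g x|%:E <= A%:E)%E.
Proof.
have [B ellB] := ell_sqrt_growth.
pose W x : R := B * Poisson_upper_cst g * (1 + `|x|) `^ (- (3 / 2)).
have intW : leb.-integrable setT (EFin \o W).
  under [EFin \o _]eq_fun do rewrite /= EFinM; apply: integrableZl => //.
  by apply: integrable_powR_1Dnorm; lra.
exists (\int[leb]_x W x) => mu muM; rewrite /Rintegral fineK ?integrable_fin_num//.
apply: ge0_le_integral => //=.
- apply/measurable_EFinP; apply: measurableT_comp => //.
  by apply: measurable_funM; [exact: measurable_ell|exact: measurable_Poisson].
- exact: measurable_int intW.
- move=> x _; rewrite lee_fin normrM_Poisson//.
  apply: le_trans (ler_pM _ _ (ellB mu x muM) (Poisson_upper_bound g_gt0 x)) _ => //.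
    by rewrite ltW// Poisson_gt0.
  have x0 : 0 < 1 + `|x| by rewrite ltr_wpDr.
  rewrite /W mulrACA -powR_invn ?(ltW x0)// -powRD; last by rewrite (gt_eqF x0) implybT.
  by rewrite (_ : 2^-1 + _ = - (3 / 2))//; field.
Qed.
End LogPotential.

(** * Poisson integrals *)

Section PoissonIntegral.
Context {R : realType}.
Variables (g A : R) (e : R -> R).
Local Notation leb := (@lebesgue_measure R).
Hypothesis g_gt0 : 0 < g.
Hypothesis measurable_e : measurable_fun setT e.
Hypothesis L1_e : (\int[leb]_x `|e x * Poisson g x|%:E <= A%:E)%E.
Implicit Types (nu : probability R R) (K s t x : R).

Definition Poisson_integral (t : R) : R := \int[leb]_x (e x * Poisson g (x - t)).

Lemma measurable_mul_Poisson t : measurable_fun setT (fun x => e x * Poisson g (x - t)).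
Proof. by apply: measurable_funM => //; exact: measurable_PoissonB. Qed.

Lemma le_normr_mul_Poisson s t x :
  `|e x * Poisson g (x - t)| <= Harnack g (t - s) * `|e x * Poisson g (x - s)|.
Proof.
rewrite !normrM_Poisson// [leRHS]mulrCA ler_wpM2l//.
by rewrite (_ : t - s = x - s - (x - t)) ?Poisson_Harnack//; ring.
Qed.

Lemma integral_normr_mul_Poisson_le t :
  (\int[leb]_x `|e x * Poisson g (x - t)|%:E <= (Harnack g t * A)%:E)%E.
Proof.
have H0 := ltW (Harnack_gt0 g_gt0 t).
have mnorm s : measurable_fun setT (fun x => `|e x * Poisson g (x - s)|).
  by apply: measurableT_comp => //; exact: measurable_mul_Poisson.
apply: (@le_trans _ _ (\int[leb]_x (Harnack g t * `|e x * Poisson g (x - 0)|)%:E)%E).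
  apply: ge0_le_integral => //=.
  - by apply/measurable_EFinP; exact: mnorm.
  - by apply/measurable_EFinP; apply: measurable_funM => //; exact: mnorm.
  - by move=> x _; rewrite lee_fin -{2}[t]subr0 le_normr_mul_Poisson.
under eq_integral do rewrite EFinM.
rewrite ge0_integralZl_EFin//; last by apply/measurable_EFinP; exact: mnorm.
by under eq_integral do rewrite subr0; rewrite EFinM lee_wpmul2l.
Qed.

Lemma integrable_mul_Poisson t :
  leb.-integrable setT (EFin \o (fun x => e x * Poisson g (x - t))).
Proof.
apply/integrableP; split.
  by apply/measurable_EFinP; exact: measurable_mul_Poisson.
exact: le_lt_trans (integral_normr_mul_Poisson_le t) (ltry _).
Qed.

Lemma Rintegral_normr_mul_Poisson_le t :
  \int[leb]_x `|e x * Poisson g (x - t)| <= Harnack g t * A.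
Proof.
have intP := integrable_norm (integrable_mul_Poisson t).
by rewrite -lee_fin /Rintegral fineK ?integral_normr_mul_Poisson_le ?integrable_fin_num.
Qed.

Lemma normr_Poisson_integral_le t : `|Poisson_integral t| <= Harnack g t * A.
Proof.
apply: le_trans (Rintegral_normr_mul_Poisson_le t).
by apply: le_normr_Rintegral => //; exact: integrable_mul_Poisson.
Qed.

Lemma L1_bound_ge0 : 0 <= A.
Proof. by rewrite -lee_fin (le_trans _ L1_e)// integral_ge0. Qed.

Lemma Poisson_integral_dist s t : `|Poisson_integral t - Poisson_integral s|
  <= (Harnack g (t - s) - 1) * (Harnack g s * A).
Proof.
have ints := integrable_mul_Poisson s.
have intB := integrableB measurableT (integrable_mul_Poisson t) ints.
have intN := integrable_norm ints.
rewrite /Poisson_integral -RintegralB//; last exact: integrable_mul_Poisson.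
have H0 : 0 <= Harnack g (t - s) - 1 by rewrite subr_ge0 Harnack_ge1.
apply: le_trans (ler_wpM2l H0 (Rintegral_normr_mul_Poisson_le s)).
rewrite -RintegralZl//; apply: le_trans (le_normr_Rintegral _ intB) _ => //.
apply: le_Rintegral => //.
- exact: (integrable_norm intB).
- exact: (integrableZl _ (Harnack g (t - s) - 1) intN).
- move=> x _; rewrite -mulrBr normrM normrM_Poisson// [leRHS]mulrCA ler_wpM2l//.
  by rewrite (_ : t - s = x - s - (x - t)) ?Poisson_dist//; ring.
Qed.

Lemma continuous_Poisson_integral : continuous Poisson_integral.
Proof.
move=> s; apply/subr_cvg0/norm_cvg0P.
apply: (squeeze_cvgr (f := cst 0) (h :=
  fun t => (Harnack g (t - s) - 1) * (Harnack g s * A))).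
- by near=> t; rewrite normr_ge0 Poisson_integral_dist.
- exact: cvg_cst.
rewrite -[X in _ --> X](mul0r (Harnack g s * A)); apply: cvgMl.
have Harnack0 : Harnack g (s - s) - 1 = 0.
  by rewrite /Harnack subrr normr0 mul0r expr0n/= !addr0 subrr.
rewrite -[X in _ --> X]Harnack0; apply: cvgB; last exact: cvg_cst.
apply: (@continuous_comp _ _ _ (fun t => t - s) (Harnack g)).
  by apply: cvgB; [exact: cvg_id|exact: cvg_cst].
exact: continuous_Harnack.
Unshelve. all: by end_near. Qed.

Definition Poisson_lipschitz_cst K : R := g^-1 * (1 + 2 * K / g) * (Harnack g K * A).

Lemma Poisson_integral_lipschitz K :
  (Poisson_lipschitz_cst K).-lipschitz_[set t | `|t| <= K] Poisson_integral.
Proof.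
move=> [t s] [/= tK sK]; apply: le_trans (Poisson_integral_dist s t) _.
have tsK : `|t - s| <= 2 * K.
  by rewrite (le_trans (ler_normB _ _))// mulr2n mulrDl mul1r lerD.
rewrite /= /Poisson_lipschitz_cst mulrAC ler_pM//.
- by rewrite subr_ge0 Harnack_ge1.
- by rewrite mulr_ge0 ?L1_bound_ge0// ltW// Harnack_gt0.
- exact: Harnack_sub1_le.
- by rewrite ler_wpM2r ?L1_bound_ge0// Harnack_le// (le_trans sK)// ler_norm.
Qed.

Definition Poisson_growth_cst : R := (1 + g^-1 + g ^- 2) * A.

Lemma Poisson_integral_even_growth : even_growth Poisson_growth_cst 1 Poisson_integral.
Proof.
move=> t; apply: le_trans (normr_Poisson_integral_le t) _.
rewrite /Poisson_growth_cst mulrAC ler_wpM2r ?L1_bound_ge0//.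
exact: le_trans (ler_norm _) (Harnack_even_growth g_gt0 t).
Qed.

Lemma integrable_prod_mul_Poisson nu : finite_moments nu ->
  (leb \x nu)%E.-integrable setT (fun z => (e z.1 * Poisson g (z.1 - z.2))%:E).
Proof.
move=> hnu; have mprod : measurable_fun setT
    (fun z : measurableTypeR R * R => e z.1 * Poisson g (z.1 - z.2)).
  by apply: measurable_funM; [exact: measurableT_comp|exact: measurable_PoissonB].
apply/integrable21ltyP; first exact/measurable_EFinP.
have intH : nu.-integrable setT (EFin \o Harnack g).
  apply: (integrable_even_growth hnu _ (Harnack_even_growth g_gt0)).
  by apply: continuous_measurable_fun; exact: continuous_Harnack.
have intHA := integrableZr measurableT A intH.
apply: le_lt_trans (integrable_lty measurableT intHA).
apply: ge0_le_integral => //=.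
- by move=> t _; exact: integral_ge0.
- apply: (@measurable_fun_fubini_tonelli_G _ _ _ _ _ leb
    (fun z : measurableTypeR R * R => `|(e z.1 * Poisson g (z.1 - z.2))%:E|%E)) => //.
  by apply: measurableT_comp => //; exact/measurable_EFinP.
- exact: measurable_int intHA.
- by move=> t _; rewrite -EFinM; exact: integral_normr_mul_Poisson_le.
Qed.

Lemma Rintegral_mul_Pconv nu : finite_moments nu ->
  \int[leb]_x (e x * Pconv g nu x) = \int[nu]_t Poisson_integral t.
Proof.
move=> hnu; rewrite /Rintegral; congr fine.
have intP x : nu.-integrable setT (EFin \o (fun t => e x * Poisson g (x - t))).
  under [_ \o _]eq_fun do rewrite /= EFinM.
  by apply: integrableZl => //; exact: integrable_Poisson.
transitivity (\int[leb]_x \int[nu]_t (e x * Poisson g (x - t))%:E)%E.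
  apply: eq_integral => x _; rewrite /Pconv -[fine _]/(Rintegral _ _ _).
  rewrite -RintegralZl//; last exact: integrable_Poisson.
  by rewrite /Rintegral fineK//; apply: integrable_fin_num => //; exact: intP.
rewrite (Fubini (integrable_prod_mul_Poisson hnu)).
apply: eq_integral => t _; rewrite /Poisson_integral /Rintegral fineK//.
by apply: integrable_fin_num => //; exact: integrable_mul_Poisson.
Qed.
End PoissonIntegral.

(** * Uniform convergence *)

Lemma cvg_ereal_sup_normr (R : realType) (T I : Type) (F : set_system T) (S : set I)
    (u : T -> I -> R) : Filter F -> S !=set0 ->
  (forall eps, 0 < eps -> \forall x \near F, forall i, S i -> `|u x i| <= eps) ->
  (fun x => ereal_sup [set `|u x i|%:E | i in S]) @ F --> 0%E.
Proof.
move=> FF [i0 Si0] small; pose sup_u x := ereal_sup [set `|u x i|%:E | i in S].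
have sup_ge0 x : (0 <= sup_u x)%E.
  by apply: (@le_trans _ _ `|u x i0|%:E) => //; apply: ereal_sup_ubound; exists i0.
have sup_le eps : 0 < eps -> \forall x \near F, (sup_u x <= eps%:E)%E.
  move=> /small; apply: filterS => x ux.
  by apply: ge_ereal_sup => _ [i Si <-]; rewrite lee_fin ux.
have sup_fin x eps : (sup_u x <= eps%:E)%E -> sup_u x \is a fin_num.
  by move=> xeps; rewrite ge0_fin_numE// (le_lt_trans xeps)// ltry.
apply/fine_cvgP; split.
  by apply: filterS (sup_le 1 ltr01) => x /sup_fin.
apply/cvgr0Pnorm_le => eps /sup_le; apply: filterS => x xeps /=.
by rewrite -/(sup_u x) ger0_norm ?fine_ge0 ?sup_ge0// -lee_fin fineK// (sup_fin _ _ xeps).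
Qed.

Lemma BM_dirac0 (R : realType) (M : R) : 0 <= M -> BM M (\d_(0 : R) : probability R R).
Proof.
move=> M0 x /= supp_x; rewrite in_itv/= -ler_norml leNgt; apply/negP => Mx.
have := supp_x `|x| (le_lt_trans M0 Mx).
have -> : (\d_(0 : R) : probability R R) (ball x `|x|) = 0%E.
  rewrite -[LHS]/(\d_(0 : R) (ball x `|x|)) diracE memNset//.
  by rewrite /ball/= subr0 ltxx.
by rewrite ltxx.
Qed.

Lemma HgE (R : realType) (g A : R) (nu mu : probability R R) : 0 < g ->
  (\int[lebesgue_measure]_x `|ell g x mu * Poisson g x|%:E <= A%:E)%E ->
  finite_moments nu ->
  Hg g nu mu = \int[nu]_t Poisson_integral g (fun x => ell g x mu) t.
Proof. by move=> g0 ellA; exact: Rintegral_mul_Pconv (measurable_ell g0 mu) ellA _. Qed.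

Theorem mainTheorem7 (R : realType)
    (nu nub : nat -> probability R R)
    (hnu : forall d, finite_moments (nu d))
    (hnub : forall d, compactly_supported (nub d))
    (hmom : forall k : nat,
        (fun d => `| moment (nu d) k - moment (nub d) k |) @ \oo --> (0 : R))
    (hsupp : exists2 M' : R, 0 < M' & forall d, msupport (nub d) `<=` `[- M', M'])
    : forall g M : R, 0 < g -> 0 < M ->
      (fun d => ereal_sup
         [set (`| Hg g (nu d) mu - Hg g (nub d) mu |)%:E | mu in BM M])
        @ \oo --> (0 : \bar R)%E.
Proof.
move=> g M g0 M0; have [M' M'0 nubM'] := hsupp.
have hnub_moments d : finite_moments (nub d) by exact: msupport_finite_moments (nubM' d).
have [A ell_L1] := ell_Poisson_L1_bounded M g0.
apply: cvg_ereal_sup_normr => [|eps eps0].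
  by exists (\d_(0 : R) : probability R R); apply: BM_dirac0; exact: ltW.
have M'1 : M' < M' + 1 by rewrite ltrDl.
have := moments_merge_Rintegral (Poisson_lipschitz_cst g A (M' + 1))
  (Poisson_growth_cst g A) 1 hmom hnu nubM' M'0 M'1 eps0.
apply: filterS => d merge mu muM.
have mell := measurable_ell g0 mu; have ellA := ell_L1 mu muM.
rewrite !(HgE g0 ellA)//; apply: merge.
- by apply: continuous_measurable_fun; exact: continuous_Poisson_integral ellA.
- exact: Poisson_integral_lipschitz.
- exact: Poisson_integral_even_growth.
Qed.
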